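(* Under the Qualification assumption, let $(m_1,\pi,u,\gamma,P)\in\mathcal R\times\mathcal K$ be a solution to the mean field game system (MFG), and let $$w(t,x,\cdot)=m_1(t,x)\pi(t,x,\cdot)\ \ \text{for }(t,x)\in\mathcal T\times S,\qquad m_2=m_1,\qquad D=\mathbf A w .$$ Then $(m_1,w,m_2,D)$ and $(u,\gamma,P)$ are respectively solutions to $(\mathfrak P)$ and $(\mathfrak D)$. Moreover, $(m_1,w)$ is a solution to $(\tilde P)$, $(m_1,\pi)$ is a solution to $(P)$, and $(\gamma,P)$ is a solution to $(\tilde D)$.
   Context: Let $T\ge 1$, $n\ge 1$ be integers, $\mathcal T=\{0,\dots,T-1\}$, $\bar{\mathcal T}=\{0,\dots,T\}$, $S=\{0,\dots,n-1\}$. For a finite set $A$, $\mathbb R(A)$ is the space of functions $A\to\mathbb R$ (Euclidean inner product and norm). $\Delta(S)=\{\rho:S\to[0,1]:\sum_{x}\rho(x)=1\}$, $\Delta=\{\pi:\mathcal T\times S\times S\to[0,1]:\pi(t,x,\cdot)\in\Delta(S)\ \forall(t,x)\}$. Spaces: $\mathcal R=\mathbb R(\bar{\mathcal T}\times S)\times\mathbb R(\mathcal T\times S^2)$, $\mathcal U=\mathbb R(\bar{\mathcal T}\times S)\times\mathbb R(\mathcal T)$, $\mathcal C=\mathcal R\times\mathbb R(\bar{\mathcal T}\times S)\times\mathbb R(\mathcal T)$, $\mathcal K=\mathbb R(\bar{\mathcal T}\times S)\times\mathcal U$. Data: $m_0\in\Delta(S)$, $\alpha:\mathcal T\times S^2\to\mathbb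 R$, $\ell:\mathcal T\times S\times\mathbb R(S)\to\mathbb R\cup\{+\infty\}$, $\phi:\mathcal T\times\mathbb R\to\mathbb R\cup\{+\infty\}$, $F:\bar{\mathcal T}\times\mathbb R(S)\to\mathbb R\cup\{+\infty\}$. Standing assumption: for all $(t,s,x)\in\mathcal T\times\bar{\mathcal T}\times S$ the functions $\ell(t,x,\cdot)$, $F(s,\cdot)$, $\phi(t,\cdot)$ are proper, convex and lower semicontinuous, and $\mathrm{dom}(\ell(t,x,\cdot))\subseteq\Delta(S)$. Fenchel conjugates $\ell^\star,F^\star,\phi^\star$ and subdifferentials are in the last variable. System (MFG), for $(m,\pi,u,\gamma,P)\in\mathcal R\times\mathcal K$ and all $(t,s,x)\in\mathcal T\times\bar{\mathcal T}\times S$: (i) $u(t,x)=\inf_{\rho\in\Delta(S)}\big[\ell(t,x,\rho)+\gamma(t,x)+\sum_{y\in S}\rho(y)(\alpha(t,x,y)P(t)+u(t+1,y))\big]$, $u(T,x)=\gamma(T,x)$; (ii) $\pi(t,x,\cdot)\in\Delta(S)$ attains the infimum in (i); (iii) $m(t+1,x)=\sum_{y\in S}m(t,y)\pi(t,y,x)$, $m(0,x)=m_0(x)$; (iv) $\gamma(s,\cdot)\in\partial F(s,m(s,\cdot))$; (v) $P(t)\in\partial\phi\big(t,\sum_{(x,y)\in S^2}m(t,x)\pi(t,x,y)\alpha(t,x,y)\big)$. Operators: $\mathbf A[w](t)=\sum_{(x,y)\in S^2}w(t,x,y)\alpha(t,x,y)$; $\mathbf S[w](s,x)=\sum_{y\in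 S}w(s-1,y,x)$ if $s>0$, and $\mathbf S[w](0,x)=0$. $\bar m_0(0,x)=m_0(x)$, $\bar m_0(s,x)=0$ for $s>0$. Perspective: $\tilde\ell(t,x,\theta,z)=\theta\,\ell(t,x,z/\theta)$ if $\theta>0$; $=0$ if $(\theta,z)=(0,0)$; $=+\infty$ otherwise. Problem $(P)$: minimize $\sum_{(t,x)\in\mathcal T\times S}m(t,x)\ell(t,x,\pi(t,x,\cdot))+\sum_{t\in\mathcal T}\phi(t,\sum_{(x,y)}m(t,x)\pi(t,x,y)\alpha(t,x,y))+\sum_{s\in\bar{\mathcal T}}F(s,m(s,\cdot))$ (with $0\cdot(+\infty)=0$) over $\pi\in\Delta$ and $m=m^\pi$, the solution of (iii). Problem $(\tilde P)$: minimize $\sum_{(t,x)\in\mathcal T\times S}\tilde\ell(t,x,m(t,x),w(t,x,\cdot))+\sum_{t\in\mathcal T}\phi(t,\mathbf A[w](t))+\sum_{s\in\bar{\mathcal T}}F(s,m(s,\cdot))$ over $(m,w)\in\mathcal R$ subject to $\mathbf S w-m+\bar m_0=0$. Problem $(\mathfrak P)$: $\inf_{\mathcal C}\mathcal F(m_1,w,m_2,D)+\mathcal G(\mathcal A(m_1,w,m_2,D))$, where $\mathcal F(m_1,w,m_2,D)=\sum_{(t,x)\in\mathcal T\times S}\tilde\ell(t,x,m_1(t,x),w(t,x,\cdot))+\sum_{t\in\mathcal T}\phi(t,D(t))+\sum_{s\in\bar{\mathcal T}}F(s,m_2(s,\cdot))$; $\mathcal G(y_1,y_2,y_3)=0$ if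 $y_1=-\bar m_0$, $y_2=0$, $y_3=0$ and $+\infty$ otherwise on $\mathcal K$; $\mathcal A(m_1,w,m_2,D)=(\mathbf S w-m_1,m_1-m_2,\mathbf A w-D)$. Problem $(\mathfrak D)$: $\inf_{(u,\gamma,P)\in\mathcal K}\mathcal F^\star(-\mathcal A^\star(u,\gamma,P))+\mathcal G^\star(u,\gamma,P)$, with Fenchel conjugates and adjoint. Problem $(\tilde D)$: maximize over $(\gamma,P)\in\mathcal U$ the quantity $\sum_{x}m_0(x)\mathbf U[\gamma,P](0,x)-\sum_{t\in\mathcal T}\phi^\star(t,P(t))-\sum_{s\in\bar{\mathcal T}}F^\star(s,\gamma(s,\cdot))$, where $u=\mathbf U[\gamma,P]$ solves $u(t,x)+\ell^\star(t,x,-\alpha(t,x,\cdot)P(t)-u(t+1,\cdot))=\gamma(t,x)$ on $\mathcal T\times S$, $u(T,\cdot)=\gamma(T,\cdot)$. Qualification assumption: there exists $\alpha_0>0$ such that for every $\varepsilon=(\varepsilon_1,\varepsilon_2,\varepsilon_3)\in\mathcal K$ with $\|\varepsilon\|\le\alpha_0$ there exists $\pi:\mathcal T\times S\times S\to\mathbb R$ with $\pi(t,x,\cdot)\in\mathrm{dom}(\ell(t,x,\cdot))$ for all $(t,x)$ such that $m_1[\varepsilon,\pi]\ge0$, $m_2[\varepsilon,\pi](s,\cdot)\in\mathrm{dom}(F(s,\cdot))$ for all $s\in\bar{\mathcal T}$, and $D[\varepsilon,\pi](t)\in\mathrm{dom}(\phi(t,\cdot))$ for all $t\in\mathcal T$.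 Here $m_1=m_1[\varepsilon,\pi]$ solves $m_1(0,x)-\varepsilon_1(0,x)=m_0(x)$, $m_1(t+1,x)=\sum_{y\in S}m_1(t,y)\pi(t,y,x)-\varepsilon_1(t+1,x)$; $m_2[\varepsilon,\pi]=m_1[\varepsilon,\pi]+\varepsilon_2$; $D[\varepsilon,\pi](t)=\sum_{(x,y)\in S^2}m_1[\varepsilon,\pi](t,x)\pi(t,x,y)\alpha(t,x,y)+\varepsilon_3(t)$. *)

(* Defs.v *)
From HB Require Import structures.
From mathcomp Require Import all_boot all_order all_algebra.
From mathcomp Require Import all_classical all_reals all_analysis.
From mathcomp Require Import ring.

Set Implicit Arguments.
Unset Strict Implicit.
Unset Printing Implicit Defensive.

Import Order.TTheory GRing.Theory Num.Theory.
Import numFieldNormedType.Exports.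

Local Open Scope classical_set_scope.
Local Open Scope ring_scope.

(* Conventions.  The state space S is 'I_n, the times 0..T-1 are 'I_T and the
   times 0..T are 'I_T.+1.  A function on S is a row vector, a function on
   {0..T} x S is a matrix (one row per time), a function on {0..T-1} x S x S is
   a family of matrices indexed by time, a function on {0..T-1} is a row vector.

   Functions with values in R U {+oo} have type _ -> \bar R, and [eproper] rules
   out -oo.  No sum below of values of such functions mixes +oo and -oo, and
   0 * +oo = 0 in \bar R. *)

Notation spaceR R T n :=
  ('M[R]_(T.+1, n) * ('I_T -> 'M[R]_n))%type (only parsing).
Notation spaceU R T n := ('M[R]_(T.+1, n) * 'rV[R]_T)%type (only parsing).
(* elements ((m1, w), m2, D) *)
Notation spaceC R T n :=
  (('M[R]_(T.+1, n) * ('I_T -> 'M[R]_n)) * 'M[R]_(T.+1, n) * 'rV[R]_T)%type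
  (only parsing).
(* elements (u, (gamma, P)) *)
Notation spaceK R T n :=
  ('M[R]_(T.+1, n) * ('M[R]_(T.+1, n) * 'rV[R]_T))%type (only parsing).

Definition same_time (T : nat) (t : 'I_T) : 'I_T.+1 := widen_ord (leqnSn T) t.
Definition succ_time (T : nat) (t : 'I_T) : 'I_T.+1 := lift ord0 t.

Section InnerProducts.
Variables (R : realType) (T n : nat).

Definition dotM (p q : nat) (a b : 'M[R]_(p, q)) : R :=
  \sum_i \sum_j a i j * b i j.

Definition dotW (v w : 'I_T -> 'M[R]_n) : R := \sum_t dotM (v t) (w t).

Definition dotC (c d : spaceC R T n) : R :=
  let: ((m1, w), m2, D) := c in
  let: ((m1', w'), m2', D') := d in
  dotM m1 m1' + dotW w w' + dotM m2 m2' + dotM D D'.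

Definition dotK (k l : spaceK R T n) : R :=
  let: (u, (gamma, P)) := k in
  let: (u', (gamma', P')) := l in
  dotM u u' + dotM gamma gamma' + dotM P P'.

Definition normK (k : spaceK R T n) : R := Num.sqrt (dotK k k).

End InnerProducts.

(* The point x with <L v, y> = <v, x> for all v; see [adjoint_opCKP]. *)
Definition adjoint (R : realType) (V W : zmodType)
    (dotV : V -> V -> R) (dotW : W -> W -> R) (L : V -> W) (y : W) : V :=
  xget 0 [set x | forall v, dotW (L v) y = dotV v x].

Section ConvexAnalysis.
Variable R : realType.

Definition edom (V : Type) (f : V -> \bar R) : set V :=
  [set x | (f x < +oo)%E].

Definition eproper (V : Type) (f : V -> \bar R) : Prop :=
  (forall x, f x != -oo%E) /\ exists x, (f x < +oo)%E.

Definition econvex (V : lmodType R) (f : V -> \bar R) : Prop :=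
  forall (x y : V) (a : R), 0 <= a <= 1 ->
    (f (a *: x + (1 - a) *: y)%R <= a%:E * f x + (1 - a)%R%:E * f y)%E.

Definition fenchel (V : Type) (dot : V -> V -> R) (f : V -> \bar R) (y : V)
    : \bar R :=
  ereal_sup [set ((dot x y)%:E - f x)%E | x in [set: V]].

Definition subdiff (V : zmodType) (dot : V -> V -> R) (f : V -> \bar R) (x : V)
    : set V :=
  [set y | forall z, (f x + (dot (z - x)%R y)%:E <= f z)%E].

Definition perspective (V : lmodType R) (f : V -> \bar R) (theta : R) (z : V)
    : \bar R :=
  if 0 < theta then (theta%:E * f (theta^-1 *: z)%R)%E
  else if (theta == 0) && (z == 0) then 0%E else +oo%E.

Definition dotR (a b : R) : R := a * b.

Definition is_minimizer (X : Type) (A : set X) (f : X -> \bar R) (x : X) : Prop :=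
  A x /\ forall y, A y -> (f x <= f y)%E.

Definition is_maximizer (X : Type) (A : set X) (f : X -> \bar R) (x : X) : Prop :=
  A x /\ forall y, A y -> (f y <= f x)%E.

Definition simplex (n : nat) : set 'rV[R]_n :=
  [set rho | (forall x, 0 <= rho 0 x <= 1) /\ \sum_x rho 0 x = 1].

End ConvexAnalysis.
Arguments simplex R n : clear implicits.

Section MeanFieldGame.
Variables (R : realType) (T n : nat).
Variables (m0 : 'rV[R]_n) (alpha : 'I_T -> 'M[R]_n).
Variables (ell : 'I_T -> 'I_n -> 'rV[R]_n -> \bar R).
Variables (phi : 'I_T -> R -> \bar R).
Variables (F : 'I_T.+1 -> 'rV[R]_n -> \bar R).

Implicit Types (m u gamma : 'M[R]_(T.+1, n)) (w pi : 'I_T -> 'M[R]_n).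
Implicit Types (P D : 'rV[R]_T).

Definition standing_assumption : Prop :=
  (forall t x, [/\ eproper (ell t x), econvex (ell t x),
                   lower_semicontinuous (ell t x) &
                   edom (ell t x) `<=` simplex R n]) /\
  (forall s, [/\ eproper (F s), econvex (F s) & lower_semicontinuous (F s)]) /\
  (forall t, [/\ eproper (phi t), econvex (phi t : R^o -> \bar R) &
                 lower_semicontinuous (phi t)]).

Definition Delta : set ('I_T -> 'M[R]_n) :=
  [set pi | forall t x, simplex R n (row x (pi t))].

Definition demand m pi (t : 'I_T) : R :=
  \sum_x \sum_y m (same_time t) x * pi t x y * alpha t x y.

Definition fokker_planck m pi : Prop :=
  (forall t x, m (succ_time t) x = \sum_y m (same_time t) y * pi t y x) /\
  (forall x, m ord0 x = m0 0 x).

Definition bellman_cost u gamma P (t : 'I_T) (x : 'I_n) (rho : 'rV[R]_n)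
    : \bar R :=
  (ell t x rho + (gamma (same_time t) x)%:E
   + (\sum_y rho 0 y * (alpha t x y * P 0 t + u (succ_time t) y))%R%:E)%E.

Definition bellman_inf u gamma P (t : 'I_T) (x : 'I_n) : \bar R :=
  ereal_inf [set bellman_cost u gamma P t x rho | rho in simplex R n].

Definition MFG_solution m pi u gamma P : Prop :=
  [/\ (forall t x, (u (same_time t) x)%:E = bellman_inf u gamma P t x) /\
      (forall x, u ord_max x = gamma ord_max x),
      forall t x, simplex R n (row x (pi t)) /\
        bellman_cost u gamma P t x (row x (pi t)) = bellman_inf u gamma P t x,
      fokker_planck m pi,
      forall s, subdiff (@dotM R 1 n) (F s) (row s m) (row s gamma) &
      forall t, subdiff (@dotR R) (phi t) (demand m pi t) (P 0 t)].

Definition opA w : 'rV[R]_T := \row_t \sum_x \sum_y w t x y * alpha t x y.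

(* [unlift ord0 s] is [Some (s - 1)] if s > 0 and [None] if s = 0. *)
Definition opS w : 'M[R]_(T.+1, n) :=
  \matrix_(s, x) if unlift ord0 s is Some t then \sum_y w t y x else 0.

Definition m0bar : 'M[R]_(T.+1, n) :=
  \matrix_(s, x) if s == ord0 then m0 0 x else 0.

Definition cost_P (z : spaceR R T n) : \bar R :=
  let: (m, pi) := z in
  (\sum_t \sum_x (m (same_time t) x)%:E * ell t x (row x (pi t))
   + \sum_t phi t (demand m pi t) + \sum_s F s (row s m))%E.

Definition solution_P (z : spaceR R T n) : Prop :=
  is_minimizer [set y | Delta y.2 /\ fokker_planck y.1 y.2] cost_P z.

Definition cost_Ptilde (z : spaceR R T n) : \bar R :=
  let: (m, w) := z in
  (\sum_t \sum_x perspective (ell t x) (m (same_time t) x) (row x (w t))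
   + \sum_t phi t (opA w 0 t)%R + \sum_s F s (row s m))%E.

Definition solution_Ptilde (z : spaceR R T n) : Prop :=
  is_minimizer [set y | opS y.2 - y.1 + m0bar = 0] cost_Ptilde z.

Definition calF (c : spaceC R T n) : \bar R :=
  let: ((m1, w), m2, D) := c in
  (\sum_t \sum_x perspective (ell t x) (m1 (same_time t) x) (row x (w t))
   + \sum_t phi t (D 0 t)%R + \sum_s F s (row s m2))%E.

Definition calG (k : spaceK R T n) : \bar R :=
  let: (y1, (y2, y3)) := k in
  if [&& y1 == - m0bar, y2 == 0 & y3 == 0] then 0%E else +oo%E.

Definition opCK (c : spaceC R T n) : spaceK R T n :=
  let: ((m1, w), m2, D) := c in (opS w - m1, (m1 - m2, opA w - D)).

Definition solution_frakP (c : spaceC R T n) : Prop :=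
  is_minimizer setT (fun c => calF c + calG (opCK c))%E c.

Definition opCK_adj : spaceK R T n -> spaceC R T n :=
  adjoint (@dotC R T n) (@dotK R T n) opCK.

Definition solution_frakD (k : spaceK R T n) : Prop :=
  is_minimizer setT
    (fun k => fenchel (@dotC R T n) calF (- opCK_adj k)%R
              + fenchel (@dotK R T n) calG k)%E k.

Definition backward_eq gamma P u : Prop :=
  (forall t x,
    ((u (same_time t) x)%:E
     + fenchel (@dotM R 1 n) (ell t x)
         (\row_y (- alpha t x y * P 0 t - u (succ_time t) y))%R)%E
    = (gamma (same_time t) x)%:E) /\
  (forall x, u ord_max x = gamma ord_max x).

(* The default value 0 is never used: under the standing assumption the
   conjugate of [ell t x] is finite everywhere, because the domain of [ell t x]
   is bounded, so the backward recursion has exactly one solution. *)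
Definition backwardU gamma P : 'M[R]_(T.+1, n) :=
  xget 0 [set u | backward_eq gamma P u].

Definition value_Dtilde (z : spaceU R T n) : \bar R :=
  let: (gamma, P) := z in
  ((\sum_x m0 0 x * backwardU gamma P ord0 x)%R%:E
   - \sum_t fenchel (@dotR R) (phi t) (P 0 t)%R
   - \sum_s fenchel (@dotM R 1 n) (F s) (row s gamma))%E.

Definition solution_Dtilde (z : spaceU R T n) : Prop :=
  is_maximizer setT value_Dtilde z.

Definition perturbed_fokker_planck (eps1 : 'M[R]_(T.+1, n)) pi m : Prop :=
  (forall x, m ord0 x - eps1 ord0 x = m0 0 x) /\
  (forall t x, m (succ_time t) x
    = \sum_y m (same_time t) y * pi t y x - eps1 (succ_time t) x).

Definition qualification : Prop :=
  exists2 a0 : R, 0 < a0 &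
  forall eps1 eps2 (eps3 : 'rV[R]_T),
    normK (eps1, (eps2, eps3)) <= a0 ->
  exists pi m1,
    [/\ forall t x, edom (ell t x) (row x (pi t)),
        perturbed_fokker_planck eps1 pi m1,
        forall s x, 0 <= m1 s x,
        forall s, edom (F s) (row s (m1 + eps2)) &
        forall t, edom (phi t) (demand m1 pi t + eps3 0 t)].

End MeanFieldGame.

Section AdjointOpCK.
Variables (R : realType) (T n : nat) (alpha : 'I_T -> 'M[R]_n).

Lemma adjoint_opCKP (c : spaceC R T n) (k : spaceK R T n) :
  dotK (opCK alpha c) k = dotC c (opCK_adj alpha k).
Proof.
move: c; rewrite /opCK_adj /adjoint.
case: xgetP => [x _ //|/=].
case: k => u [gamma P] /(_ ((gamma - u,
  fun t => \matrix_(x, y) (u (succ_time t) y + alpha t x y * P 0 t)), - gamma, - P)).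
case=> -[[[m1 w] m2] D] /=.
have dotB p q (a a' b : 'M[R]_(p, q)) : dotM (a - a') b = dotM a b - dotM a' b.
  rewrite /dotM -sumrB; apply: eq_bigr => i _; rewrite -sumrB.
  by apply: eq_bigr => j _; rewrite !mxE mulrBl.
have dotMC p q (a b : 'M[R]_(p, q)) : dotM a b = dotM b a.
  by apply: eq_bigr => i _; apply: eq_bigr => j _; rewrite mulrC.
have dotN p q (a b : 'M[R]_(p, q)) : dotM a (- b) = - dotM a b.
  rewrite -[- b]sub0r dotMC dotB (dotMC _ _ b) [X in X - _](_ : _ = 0) ?sub0r//.
  by apply: big1 => i _; apply: big1 => j _; rewrite mxE mul0r.
have dotS : dotM (opS w) u = \sum_t \sum_x \sum_y w t x y * u (succ_time t) y.
  rewrite [LHS]big_ord_recl [X in X + _]big1 ?add0r; last first.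
    by move=> j _; rewrite /opS mxE unlift_none mul0r.
  apply: eq_bigr => t _; rewrite [RHS]exchange_big; apply: eq_bigr => y _.
  by rewrite /opS mxE liftK mulr_suml.
have dotA : dotM (opA alpha w) P =
    \sum_t \sum_x \sum_y w t x y * (alpha t x y * P 0 t).
  rewrite [LHS]big_ord1; apply: eq_bigr => t _; rewrite /opA mxE mulr_suml.
  by apply: eq_bigr => x _; rewrite mulr_suml; apply: eq_bigr => y _; rewrite mulrA.
have -> : dotW w (fun t => \matrix_(x, y) (u (succ_time t) y + alpha t x y * P 0 t))
    = dotM (opS w) u + dotM (opA alpha w) P.
  rewrite dotS dotA -big_split; apply: eq_bigr => t _.
  rewrite -big_split; apply: eq_bigr => x _.
  by rewrite -big_split; apply: eq_bigr => y _; rewrite mxE mulrDr.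
by rewrite !dotB !dotN (dotMC _ _ m1 (_ - _)) dotB !(dotMC _ _ _ m1); ring.
Qed.

End AdjointOpCK.

(* Main.v *)
Require Import Defs.
From mathcomp Require Import all_boot all_order all_algebra.
From mathcomp Require Import all_classical all_reals all_analysis.
From mathcomp Require Import ring lra zify.
Import Order.TTheory GRing.Theory Num.Theory.
Import numFieldNormedType.Exports.
Local Open Scope ring_scope.

(** The system states the optimality conditions of a convex program, so the
    theorem is a Lagrangian duality argument, in which every duality gap is a
    sum of local Fenchel-Young gaps.

    Pair the constraints [opCK alpha c] with the multipliers [(u, (gamma, P))]
    and move the operators onto the multipliers ([dotK_opCK], a discrete Green
    formula).  The result splits into one term for each pair [(t, x)], each time
    [t] and each time [s], matching the terms of the cost [calF c].  If [u]
    solves the backward equation for [(gamma, P)], the perspective term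
    at [(t, x)] is bounded below by a linear function of [(m, w)]
    ([perspective_ge]), and the terms in [phi] and [F] are bounded below by the
    Fenchel-Young inequality.  Adding up gives weak duality ([calF_ge]): for all
    [c],
      calF c + <opCK c, (u, gamma, P)>
        >= - \sum_t phi^* (P t) - \sum_s F^* (gamma s).

    At a solution of the system all these inequalities are equalities between
    real numbers ([calF_MFG]).  The Bellman equation with its minimizer [pi] is
    the backward equation together with equality in the perspective terms
    ([bellman_fenchel], [MFG_backward_eq]); the inclusions that define [gamma]
    and [P] are equality in the other terms ([fenchel_subdiff]).  Hence the
    primal value and the opposite of the dual value agree, and all five
    assertions follow by comparison:
    - feasible points of the flux formulation have [opCK c] equal to the fixed
      vector [(- m0bar, (0, 0))], for which weak duality bounds the cost from
      below by the value reached;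
    - a feasible pair [(m, pi)] and its flux [w = m pi] have the same cost,
      since [m] is nonnegative and perspectives are homogeneous
      ([perspective_scale]), which transfers optimality to controls;
    - for arbitrary multipliers, testing the two conjugates of the dual objective
      at the optimal primal point bounds it below by the opposite of the primal
      value, which weak duality shows to be reached;
    - weak duality applied to the optimal primal point bounds the values of
      the reduced dual, once the backward equation is known to have exactly one
      solution for every [(gamma, P)].

    The last point needs the conjugates of the running costs to be finite
    everywhere.  The Bellman equation has a real value at [(t, x)], which makes
    one value of the conjugate finite; the domain of the running cost is
    bounded, so all values are ([fenchel_fin_num]). *)

(** * The inner product of matrices *)

Section DotM.
Context {R : realType}.

Lemma dotMBl {p q : nat} (a a' b : 'M[R]_(p, q)) :
  dotM (a - a') b = dotM a b - dotM a' b.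
Proof.
rewrite /dotM -sumrB; apply: eq_bigr => i _; rewrite -sumrB.
by apply: eq_bigr => j _; rewrite !mxE mulrBl.
Qed.

Lemma dotM0l {p q : nat} (b : 'M[R]_(p, q)) : dotM 0 b = 0.
Proof. by rewrite -(subrr 0) dotMBl subrr. Qed.

Lemma dotMNr {p q : nat} (a b : 'M[R]_(p, q)) : dotM a (- b) = - dotM a b.
Proof.
rewrite /dotM -sumrN; apply: eq_bigr => i _; rewrite -sumrN.
by apply: eq_bigr => j _; rewrite mxE mulrN.
Qed.

Lemma dotMZl {p q : nat} c (a b : 'M[R]_(p, q)) :
  dotM (c *: a) b = c * dotM a b.
Proof.
rewrite /dotM mulr_sumr; apply: eq_bigr => i _; rewrite mulr_sumr.
by apply: eq_bigr => j _; rewrite mxE mulrA.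
Qed.

Lemma dotM_rowE {q : nat} (a b : 'rV[R]_q) : dotM a b = \sum_j a 0 j * b 0 j.
Proof. exact: big_ord1. Qed.

Lemma dotM_sum_row {p q : nat} (a b : 'M[R]_(p, q)) :
  dotM a b = \sum_i dotM (row i a) (row i b).
Proof.
apply: eq_bigr => i _; rewrite dotM_rowE.
by apply: eq_bigr => j _; rewrite !mxE.
Qed.

End DotM.

(** * Conjugates and subgradients *)

Section Fenchel.
Context {R : realType}.

Lemma fenchel_ge {V : Type} (dot : V -> V -> R) (f : V -> \bar R) (x y : V) :
  ((dot x y)%:E - f x <= fenchel dot f y)%E.
Proof. by apply: ereal_sup_ubound; exists x. Qed.

Lemma fenchel_neqNy {V : Type} (dot : V -> V -> R) (f : V -> \bar R) (y : V) :
  eproper f -> fenchel dot f y != -oo%E.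
Proof.
case=> fNy [x fx]; have := fenchel_ge dot f x y.
by have := fNy x; case: (f x) fx => // r _ _; case: fenchel.
Qed.

Lemma fenchel_young {V : Type} (dot : V -> V -> R) (f : V -> \bar R) (x y : V) :
  f x != -oo%E -> ((dot x y)%:E - fenchel dot f y <= f x)%E.
Proof.
have := fenchel_ge dot f x y.
case: (f x) => [r| |]//; last by rewrite leey.
case: fenchel => [s| |]//; rewrite -?EFinB ?lee_fin ?leNye//.
by move=> rs _; rewrite lerBlDr addrC -lerBlDr.
Qed.

(** Where [y] is a subgradient, the Fenchel-Young inequality is an equality
    between real numbers. *)
Lemma fenchel_subdiff {V : zmodType} (dot : V -> V -> R) (f : V -> \bar R)
    (x y : V) :
  (forall z, dot (z - x) y = dot z y - dot x y) ->
  eproper f -> subdiff dot f x y ->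
  exists2 r : R, f x = r%:E & fenchel dot f y = (dot x y - r)%:E.
Proof.
move=> dotB [fNy [z0 fz0]] fxy.
have [r fxr] : exists r, f x = r%:E.
  by have := fxy z0; have := fNy x; case: (f x) => [r| |]//; [exists r|
    rewrite /= leye_eq => _ /eqP fz0y; rewrite fz0y in fz0].
exists r => //; apply/eqP; rewrite eq_le; apply/andP; split; last first.
  by rewrite EFinB -fxr; exact: fenchel_ge.
apply: ge_ereal_sup => _ [z _ <-].
have := fxy z; rewrite fxr dotB; case: (f z) (fNy z) => [s| |]//.
  by move=> _; rewrite -EFinD -EFinB !lee_fin => H; lra.
by move=> _ _; rewrite leNye.
Qed.

Lemma sum_fenchel_young {I : finType} {V : Type} (dot : V -> V -> R)
    (f : I -> V -> \bar R) (x y : I -> V) : (forall i, eproper (f i)) ->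
  ((\sum_i dot (x i) (y i))%:E - \sum_i fenchel dot (f i) (y i)
   <= \sum_i f i (x i))%E.
Proof.
move=> pf; rewrite -sumEFin -sumeN; last first.
  move=> i j _ _; apply: ltninfty_adde_def;
    by rewrite inE ltNye fenchel_neqNy.
rewrite -big_split; apply: lee_sum => i _.
by apply: fenchel_young; case: (pf i).
Qed.

Lemma sum_fenchel_subdiff {I : finType} {V : zmodType} (dot : V -> V -> R)
    (f : I -> V -> \bar R) (x y : I -> V) :
  (forall i z, dot (z - x i) (y i) = dot z (y i) - dot (x i) (y i)) ->
  (forall i, eproper (f i)) -> (forall i, subdiff dot (f i) (x i) (y i)) ->
  exists2 r : R, (\sum_i f i (x i))%E = r%:E &
    (\sum_i fenchel dot (f i) (y i))%E = (\sum_i dot (x i) (y i) - r)%:E.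
Proof.
move=> dotB pf fxy.
have E i : f i (x i) = (fine (f i (x i)))%:E /\
    fenchel dot (f i) (y i) = (dot (x i) (y i) - fine (f i (x i)))%:E.
  by have [r -> ->] := fenchel_subdiff _ _ _ _ (dotB i) (pf i) (fxy i).
exists (\sum_i fine (f i (x i))).
  by rewrite -sumEFin; apply: eq_bigr => i _; case: (E i).
by rewrite -sumrB -sumEFin; apply: eq_bigr => i _; case: (E i).
Qed.

End Fenchel.

Section Perspective.
Context {R : realType} {V : lmodType R}.
Implicit Types (f : V -> \bar R) (theta : R) (z : V).

(** Perspectives are positively homogeneous, so they turn the affine minorant
    [a + l z] of [f] into the linear minorant [theta * a + l z]. *)
Lemma perspective_ge f (l : V -> R) (a : R) theta z :
  (forall c v, l (c *: v) = c * l v) ->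
  (forall v, ((a + l v)%:E <= f v)%E) ->
  ((theta * a + l z)%:E <= perspective f theta z)%E.
Proof.
move=> lZ lf; rewrite /perspective; case: ifPn => [t0|_].
  apply: le_trans (lee_wpmul2l _ (lf _)); last by rewrite lee_fin ltW.
  by rewrite -EFinM lee_fin lZ mulrDr mulVKf ?gt_eqF.
case: ifPn => [/andP[/eqP -> /eqP ->]|_]; last by rewrite leey.
by rewrite mul0r add0r -(scale0r 0) lZ mul0r.
Qed.

(** At [theta = 0] both sides vanish, even if [f z] is infinite. *)
Lemma perspective_scale f theta z : 0 <= theta ->
  perspective f theta (theta *: z) = (theta%:E * f z)%E.
Proof.
rewrite le_eqVlt /perspective => /predU1P[<-|t0].
  by rewrite ltxx scale0r !eqxx mul0e.
by rewrite t0 scalerA mulVf ?gt_eqF// scale1r.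
Qed.

End Perspective.

(** * Backward recursions *)

Section Backward.
Context {R : realType} {T n : nat}.

Lemma backward_recursion_ex (g : 'I_T -> 'rV[R]_n -> 'rV[R]_n) (v : 'rV[R]_n) :
  exists2 u : 'M[R]_(T.+1, n), row ord_max u = v &
    forall t, row (same_time t) u = g t (row (succ_time t) u).
Proof.
(* W k is the value at time T - k *)
pose W k := iteri k
  (fun j v => if insub (T - j.+1)%N is Some t then g t v else v) v.
exists (\matrix_(s < T.+1) W (T - s)%N) => [|t].
  by rewrite rowK /= subnn.
rewrite !rowK.
have sT : (T - (T - succ_time t).+1 = t)%N.
  by rewrite /= /bump /= add1n subnSK// subKn// ltnW.
have -> : (T - same_time t = (T - succ_time t).+1)%N.
  by rewrite /= /bump /= add1n subnSK.
by rewrite /W iteriS -/(W _) sT valK.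
Qed.

Lemma backward_recursion_unique (g : 'I_T -> 'rV[R]_n -> 'rV[R]_n)
    (u u' : 'M[R]_(T.+1, n)) :
  row ord_max u = row ord_max u' ->
  (forall t, row (same_time t) u = g t (row (succ_time t) u)) ->
  (forall t, row (same_time t) u' = g t (row (succ_time t) u')) ->
  u = u'.
Proof.
move=> uT ug ug'; apply/row_matrixP => s.
have [k] : exists k, (s + k = T)%N.
  by exists (T - s)%N; rewrite subnKC// -ltnS.
elim: k s => [|k IH] s; first by rewrite addn0 => sT;
  rewrite (_ : s = ord_max)//; exact: val_inj.
move=> skT; have sT : (s < T)%N by lia.
have -> : s = same_time (Ordinal sT) by exact: val_inj.
by rewrite ug ug' IH//= /bump /=; lia.
Qed.

End Backward.

(** * The backward equation *)

Section BackwardEquation.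
Context {R : realType} {T n : nat}.
Variables (alpha : 'I_T -> 'M[R]_n) (ell : 'I_T -> 'I_n -> 'rV[R]_n -> \bar R).
Implicit Types (u gamma : 'M[R]_(T.+1, n)) (P : 'rV[R]_T).

(** The linear part, up to sign, of the cost minimized in the Bellman equation. *)
Definition slope u P (t : 'I_T) (x : 'I_n) : 'rV[R]_n :=
  \row_y (- alpha t x y * P 0 t - u (succ_time t) y).

(** Changing the slope changes a linear form by a bounded amount on the
    simplex, so finiteness at one slope propagates to all of them. *)
Lemma fenchel_fin_num (f : 'rV[R]_n -> \bar R) (b y : 'rV[R]_n) :
  eproper f -> (edom f `<=` simplex R n)%classic ->
  fenchel (@dotM R 1 n) f b \is a fin_num ->
  fenchel (@dotM R 1 n) f y \is a fin_num.
Proof.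
move=> pf domf bfin; rewrite fin_numE fenchel_neqNy//= -ltey.
set c := fenchel _ f b in bfin *.
apply: (@le_lt_trans _ _ ((\sum_i `|y 0 i - b 0 i|)%:E + c)%E); last first.
  by rewrite -(fineK bfin) -EFinD ltry.
apply: ge_ereal_sup => _ [z _ <-].
case: pf => /(_ z); case fz: (f z) => [r| |]// _ _; last by rewrite leNye.
have : ((dotM z b)%:E - f z <= c)%E by exact: fenchel_ge.
rewrite fz -(fineK bfin) -!EFinB -EFinD !lee_fin => zb.
have [z01 _] : simplex R n z by apply: domf; rewrite /edom /= fz ltry.
suff : dotM z y - dotM z b <= \sum_i `|y 0 i - b 0 i| by move=> ?; lra.
rewrite !dotM_rowE -sumrB; apply: ler_sum => i _; rewrite -mulrBr.
have /andP[z0 z1] := z01 i.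
by rewrite (le_trans (ler_norm _))// normrM ger0_norm// ler_piMl.
Qed.

(** The backward equation says that the affine function of [rho] below, whose
    slope is [slope u P t x], has the largest constant for which it stays under
    the running cost. *)
Lemma backward_eq_ge gamma P u t x (rho : 'rV[R]_n) :
  (forall z, ell t x z != -oo%E) -> backward_eq alpha ell gamma P u ->
  ((u (same_time t) x - gamma (same_time t) x + dotM rho (slope u P t x))%:E
    <= ell t x rho)%E.
Proof.
move=> lNy [/(_ t x) + _].
have := fenchel_young (@dotM R 1 n) _ rho (slope u P t x) (lNy rho).
rewrite -/(slope u P t x); case: fenchel => [s| |]// + [] <-.
by rewrite -EFinB; congr (_ <= _)%E; congr EFin; lra.
Qed.

Hypothesis ell_fin : forall t x y,
  fenchel (@dotM R 1 n) (ell t x) y \is a fin_num.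

(** The backward equation becomes a recursion once its conjugates are real. *)
Let backward_step gamma P t (v : 'rV[R]_n) : 'rV[R]_n :=
  \row_x (gamma (same_time t) x - fine (fenchel (@dotM R 1 n) (ell t x)
    (\row_y (- alpha t x y * P 0 t - v 0 y)))).

Let backward_eqP gamma P u : backward_eq alpha ell gamma P u <->
  row ord_max u = row ord_max gamma /\
  forall t, row (same_time t) u = backward_step gamma P t (row (succ_time t) u).
Proof.
have slopeE t x : (\row_y (- alpha t x y * P 0 t - row (succ_time t) u 0 y))
    = slope u P t x by apply/rowP => y; rewrite !mxE.
split=> [[ut uT]|[/rowP uT ut]]; split.
- by apply/rowP => x; rewrite !mxE.
- move=> t; apply/rowP => x; rewrite !mxE slopeE.
  have := ut t x; rewrite -/(slope u P t x) -(fineK (ell_fin _ _ _)) => -[] <-.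
  by rewrite addrK.
- move=> t x; rewrite -/(slope u P t x).
  have /rowP/(_ x) := ut t; rewrite !mxE slopeE => ->.
  by rewrite -[X in (_ + X)%E](fineK (ell_fin _ _ _)) -EFinD subrK.
- by move=> x; have := uT x; rewrite !mxE.
Qed.

Lemma backwardU_unique gamma P u :
  backward_eq alpha ell gamma P u -> backwardU alpha ell gamma P = u.
Proof.
move=> bu; apply: xget_unique => // u' /backward_eqP[uT' ut'].
move/backward_eqP : bu => -[uT ut].
by apply: (backward_recursion_unique (backward_step gamma P)) => //; rewrite uT.
Qed.

Lemma backwardUP gamma P :
  backward_eq alpha ell gamma P (backwardU alpha ell gamma P).
Proof.
have [u uT ut] :=
  backward_recursion_ex (backward_step gamma P) (row ord_max gamma).
have bu : backward_eq alpha ell gamma P u by exact/backward_eqP.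
by rewrite (backwardU_unique _ _ _ bu).
Qed.

End BackwardEquation.

Section MFGSystem.
Context {R : realType} {T n : nat}.
Variables (m0 : 'rV[R]_n) (alpha : 'I_T -> 'M[R]_n).
Variables (ell : 'I_T -> 'I_n -> 'rV[R]_n -> \bar R).
Variables (phi : 'I_T -> R -> \bar R).
Variables (F : 'I_T.+1 -> 'rV[R]_n -> \bar R).
Implicit Types (m u gamma : 'M[R]_(T.+1, n)) (w pi : 'I_T -> 'M[R]_n).
Implicit Types (P D : 'rV[R]_T).

Lemma bellman_costE u gamma P t x (rho : 'rV[R]_n) :
  bellman_cost alpha ell u gamma P t x rho =
  (ell t x rho
   + (gamma (same_time t) x - dotM rho (slope alpha u P t x))%:E)%E.
Proof.
rewrite /bellman_cost -addeA -EFinD; congr (_ + _%:E)%E; congr (_ + _).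
rewrite dotM_rowE -sumrN; apply: eq_bigr => y _; rewrite mxE; ring.
Qed.

(** An optimal feedback turns the infimum over the simplex into a conjugate,
    because the domain of the running cost lies in the simplex. *)
Lemma bellman_fenchel m pi u gamma P t x :
  (forall z, ell t x z != -oo%E) -> (edom (ell t x) `<=` simplex R n)%classic ->
  MFG_solution m0 alpha ell phi F m pi u gamma P ->
  ell t x (row x (pi t)) = (u (same_time t) x - gamma (same_time t) x
     + dotM (row x (pi t)) (slope alpha u P t x))%:E /\
  fenchel (@dotM R 1 n) (ell t x) (slope alpha u P t x)
   = (gamma (same_time t) x - u (same_time t) x)%:E.
Proof.
move=> lNy doml [[/(_ t x) uE _] /(_ t x)[_] + _ _ _]; rewrite -uE.
set rho := row x (pi t); set b := slope alpha u P t x.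
rewrite bellman_costE -/b => piE.
have lrho : ell t x rho
    = (u (same_time t) x - gamma (same_time t) x + dotM rho b)%:E.
  by case: (ell t x rho) piE => [r| |]// [] <-; congr EFin; ring.
split=> //; apply/eqP; rewrite eq_le; apply/andP; split; last first.
  (* the supremum is reached at the optimal feedback *)
  have := fenchel_ge (@dotM R 1 n) (ell t x) rho b.
  by rewrite lrho -EFinB; congr (_ <= _)%E; congr EFin; ring.
apply: ge_ereal_sup => _ [z _ <-].
case lz : (ell t x z) (lNy z) => [r| |]// _; last by rewrite leNye.
have : (bellman_inf alpha ell u gamma P t x
    <= bellman_cost alpha ell u gamma P t x z)%E.
  by apply: ereal_inf_lbound; exists z => //; apply: doml; rewrite /edom /= lz ltry.
rewrite -uE bellman_costE lz -/b -EFinD -EFinB !lee_fin => ?; lra.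
Qed.

Lemma MFG_backward_eq m pi u gamma P :
  (forall t x z, ell t x z != -oo%E) ->
  (forall t x, edom (ell t x) `<=` simplex R n)%classic ->
  MFG_solution m0 alpha ell phi F m pi u gamma P ->
  backward_eq alpha ell gamma P u.
Proof.
move=> lNy doml sol; split; last by case: sol => -[].
move=> t x; rewrite -/(slope alpha u P t x).
have [_ ->] := bellman_fenchel m pi u gamma P t x (lNy t x) (doml t x) sol.
by rewrite -EFinD addrC subrK.
Qed.

Lemma fokker_planck_ge0 m pi : simplex R n m0 ->
  (forall t x, simplex R n (row x (pi t))) -> fokker_planck m0 m pi ->
  forall s x, 0 <= m s x.
Proof.
move=> [m00 _] pi01 [mS mI] [k kT]; elim: k kT => [|k IH] kT x.
  rewrite (_ : Ordinal kT = ord0); last exact: val_inj.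
  by rewrite mI; case/andP: (m00 x).
rewrite (_ : Ordinal kT = succ_time (Ordinal (kT : (k < T)%N))); last exact: val_inj.
rewrite mS; apply: sumr_ge0 => y _; apply: mulr_ge0.
  rewrite (_ : same_time _ = Ordinal (ltnW kT)) ?IH//; exact: val_inj.
by have [/(_ x)/andP[+ _] _] := pi01 (Ordinal (kT : (k < T)%N)) y; rewrite mxE.
Qed.

(** * Flux form of the Fokker-Planck equation *)

Lemma opAE m pi w t :
  (forall t x, row x (w t) = m (same_time t) x *: row x (pi t)) ->
  opA alpha w 0 t = demand alpha m pi t.
Proof.
move=> hw; rewrite mxE; apply: eq_bigr => x _; apply: eq_bigr => y _.
by have /rowP/(_ y) := hw t x; rewrite !mxE => ->.
Qed.

(** Multiplying the feedback by the mass makes the evolution linear. *)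
Lemma fokker_planck_flux m pi w :
  (forall t x, row x (w t) = m (same_time t) x *: row x (pi t)) ->
  fokker_planck m0 m pi -> opS w - m + m0bar T m0 = 0.
Proof.
move=> hw [mS mI]; apply/matrixP => s x; rewrite !mxE.
case: unliftP => [t|] ->.
  rewrite mS (_ : lift ord0 t == ord0 = false) // addr0.
  apply/eqP; rewrite subr_eq0; apply/eqP; apply: eq_bigr => y _.
  by have /rowP/(_ x) := hw t y; rewrite !mxE.
by rewrite eqxx mI sub0r addNr.
Qed.

(** * Weak duality *)

Lemma dotM_opS w u :
  dotM (opS w) u = \sum_t \sum_x \sum_y w t x y * u (succ_time t) y.
Proof.
(* the row of time 0 of [opS w] vanishes *)
rewrite /dotM big_ord_recl [X in X + _]big1 ?add0r => [|x _]; last first.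
  by rewrite mxE unlift_none mul0r.
apply: eq_bigr => t _; rewrite exchange_big; apply: eq_bigr => y _.
by rewrite mxE liftK mulr_suml.
Qed.

Lemma dotM_opA w P :
  dotM (opA alpha w) P = \sum_t \sum_x \sum_y w t x y * (alpha t x y * P 0 t).
Proof.
rewrite dotM_rowE; apply: eq_bigr => t _; rewrite mxE mulr_suml.
apply: eq_bigr => x _; rewrite mulr_suml; apply: eq_bigr => y _.
by rewrite mulrA.
Qed.

(** Discrete Green formula: pairing the constraints with the multipliers and
    moving the operators onto the multipliers. The terminal condition kills the
    term in [m ord_max]. *)
Lemma dotK_opCK m w m2 D u gamma P :
  (forall x, u ord_max x = gamma ord_max x) ->
  - dotK (opCK alpha (((m, w), m2), D)) (u, (gamma, P)) =
  \sum_t \sum_x (m (same_time t) x * (u (same_time t) x - gamma (same_time t) x)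
                 + dotM (row x (w t)) (slope alpha u P t x))
  + \sum_t dotR (D 0 t) (P 0 t) + \sum_s dotM (row s m2) (row s gamma).
Proof.
move=> uT /=.
have dotm : dotM m u - dotM m gamma = \sum_t \sum_x
    m (same_time t) x * (u (same_time t) x - gamma (same_time t) x).
  rewrite /dotM -sumrB big_ord_recr /= [X in _ + X](_ : _ = 0) ?addr0; last first.
    by rewrite -sumrB big1// => x _; rewrite uT subrr.
  by apply: eq_bigr => t _; rewrite -sumrB; apply: eq_bigr => x _; rewrite mulrBr.
have dotw : \sum_t \sum_x dotM (row x (w t)) (slope alpha u P t x)
    = - dotM (opS w) u - dotM (opA alpha w) P.
  rewrite dotM_opS dotM_opA -opprD -big_split -sumrN; apply: eq_bigr => t _.
  rewrite -big_split -sumrN; apply: eq_bigr => x _.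
  rewrite -big_split -sumrN dotM_rowE; apply: eq_bigr => y _.
  rewrite !mxE /=; ring.
under eq_bigr do rewrite big_split.
rewrite big_split /= dotw -dotm -[\sum_t dotR _ _]dotM_rowE -dotM_sum_row !dotMBl.
ring.
Qed.

Hypothesis ell_proper : forall t x, eproper (ell t x).
Hypothesis phi_proper : forall t, eproper (phi t).
Hypothesis F_proper : forall s, eproper (F s).

(** Weak duality, before the constraints on [c] are imposed: bound the terms of
    the Green formula one by one. *)
Lemma calF_ge c u gamma P : backward_eq alpha ell gamma P u ->
  ((- dotK (opCK alpha c) (u, (gamma, P)))%:E
   - \sum_t fenchel (@dotR R) (phi t) (P 0 t)%R
   - \sum_s fenchel (@dotM R 1 n) (F s) (row s gamma)
   <= calF ell phi F c)%E.
Proof.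
case: c => [[[m w] m2] D] bu; rewrite dotK_opCK; last by case: bu.
rewrite !EFinD -[X in (X <= _)%E]addeA [X in (X <= _)%E]addeACA.
rewrite -[X in (X + _ <= _)%E]addeA; apply: leeD; first apply: leeD.
- rewrite -sumEFin; apply: lee_sum => t _; rewrite -sumEFin.
  apply: lee_sum => x _.
  apply: (perspective_ge _ (fun v => dotM v (slope alpha u P t x))) => [c v|v].
    exact: dotMZl.
  by apply: backward_eq_ge => // z; case: (ell_proper t x).
- exact: sum_fenchel_young.
- exact: sum_fenchel_young.
Qed.

(** * Strong duality at a solution of the system *)

(** Equality in weak duality, with both dual sums finite. *)
Lemma calF_MFG m pi u gamma P w :
  (forall t x, edom (ell t x) `<=` simplex R n)%classic ->
  MFG_solution m0 alpha ell phi F m pi u gamma P ->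
  (forall s x, 0 <= m s x) ->
  (forall t x, row x (w t) = m (same_time t) x *: row x (pi t)) ->
  let c := (((m, w), m), opA alpha w) in
  exists p q : R,
    [/\ (\sum_t fenchel (@dotR R) (phi t) (P 0 t)%R)%E = p%:E,
        (\sum_s fenchel (@dotM R 1 n) (F s) (row s gamma))%E = q%:E &
        calF ell phi F c = (- dotK (opCK alpha c) (u, (gamma, P)) - p - q)%:E].
Proof.
move=> doml sol m_ge0 hw c.
have lNy t x z : ell t x z != -oo%E by case: (ell_proper t x).
case: (sol) => -[_ uT] _ _ subF subphi.
have [a phia phip] : exists2 a : R, (\sum_t phi t (opA alpha w 0 t)%R)%E = a%:E &
    (\sum_t fenchel (@dotR R) (phi t) (P 0 t)%R)%E
    = (\sum_t dotR (opA alpha w 0 t) (P 0 t) - a)%:E.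
  apply: sum_fenchel_subdiff => // [t z|t]; first exact: mulrBl.
  by rewrite (opAE m pi)//; exact: subphi.
have [b Fb Fq] := sum_fenchel_subdiff (@dotM R 1 n) F (fun s => row s m)
  (fun s => row s gamma)
  (fun s z => dotMBl _ _ _) F_proper subF.
exists (\sum_t dotR (opA alpha w 0 t) (P 0 t) - a).
exists (\sum_s dotM (row s m) (row s gamma) - b); split=> //.
rewrite {}/c dotK_opCK// /calF phia Fb.
have -> : (\sum_t \sum_x
    perspective (ell t x) (m (same_time t) x) (row x (w t)))%E =
  (\sum_t \sum_x (m (same_time t) x * (u (same_time t) x - gamma (same_time t) x)
                 + dotM (row x (w t)) (slope alpha u P t x)))%:E.
  rewrite -sumEFin; apply: eq_bigr => t _; rewrite -sumEFin.
  apply: eq_bigr => x _; rewrite hw perspective_scale//.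
  have [-> _] := bellman_fenchel m pi u gamma P t x (lNy t x) (doml t x) sol.
  by rewrite -EFinM dotMZl mulrDr.
by rewrite -!EFinD; congr EFin; ring.
Qed.

Lemma dotK_m0bar u gamma P :
  dotK (- m0bar T m0, (0, 0)) (u, (gamma, P)) = - \sum_x m0 0 x * u ord0 x.
Proof.
rewrite /= !dotM0l !addr0 /dotM big_ord_recl [X in _ + X]big1 ?addr0.
  by rewrite -sumrN; apply: eq_bigr => x _; rewrite !mxE eqxx mulNr.
by move=> s _; rewrite big1// => x _; rewrite !mxE /= oppr0 mul0r.
Qed.

Lemma calGE (k : spaceK R T n) :
  calG m0 k = if k == (- m0bar T m0, (0, 0)) then 0%E else +oo%E.
Proof. by case: k => y1 [y2 y3]. Qed.

Lemma dotC_oppr (c d : spaceC R T n) : dotC c (- d) = - dotC c d.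
Proof.
case: c => -[[m w] m2] D; case: d => -[[m' w'] m2'] D'.
rewrite /dotC /= !dotMNr !opprD; congr (_ + _ + _ + _).
by rewrite /dotW -sumrN; apply: eq_bigr => t _; rewrite -dotMNr.
Qed.

End MFGSystem.

(** * Optimality *)

Theorem proposition5p2 (R : realType) (T n : nat)
    (m0 : 'rV[R]_n) (alpha : 'I_T -> 'M[R]_n)
    (ell : 'I_T -> 'I_n -> 'rV[R]_n -> \bar R)
    (phi : 'I_T -> R -> \bar R)
    (F : 'I_T.+1 -> 'rV[R]_n -> \bar R)
    (hT : (1 <= T)%N) (hn : (1 <= n)%N)
    (hm0 : simplex R n m0)
    (hstanding : standing_assumption ell phi F)
    (hqual : qualification m0 alpha ell phi F)
    (m1 : 'M[R]_(T.+1, n)) (pi : 'I_T -> 'M[R]_n)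
    (u gamma : 'M[R]_(T.+1, n)) (P : 'rV[R]_T)
    (hMFG : MFG_solution m0 alpha ell phi F m1 pi u gamma P)
    (w : 'I_T -> 'M[R]_n) (m2 : 'M[R]_(T.+1, n)) (D : 'rV[R]_T)
    (hw : forall (t : 'I_T) (x : 'I_n), row x (w t) = m1 (same_time t) x *: row x (pi t))
    (hm2 : m2 = m1)
    (hD : D = opA alpha w) :
  solution_frakP m0 alpha ell phi F ((m1, w), m2, D) /\
  solution_frakD m0 alpha ell phi F (u, (gamma, P)) /\
  solution_Ptilde m0 alpha ell phi F (m1, w) /\
  solution_P m0 alpha ell phi F (m1, pi) /\
  solution_Dtilde m0 alpha ell phi F (gamma, P).
Proof.
have lP t x : eproper (ell t x) by case: hstanding => /(_ t x)[].
have lNy t x z : ell t x z != -oo%E by case: (lP t x).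
have doml t x : (edom (ell t x) `<=` simplex R n)%classic.
  by case: hstanding => /(_ t x)[].
have FP s : eproper (F s) by case: hstanding => _ [/(_ s)[]].
have phiP t : eproper (phi t) by case: hstanding => _ [_ /(_ t)[]].
have bu : backward_eq alpha ell gamma P u by exact: MFG_backward_eq hMFG.
have [_ pi_opt hFP _ _] := hMFG.
have piD t x : simplex R n (row x (pi t)) by case: (pi_opt t x).
have m1_ge0 := fokker_planck_ge0 _ _ _ hm0 piD hFP.
have lfin t x y : fenchel (@dotM R 1 n) (ell t x) y \is a fin_num.
  apply: (fenchel_fin_num _ (slope alpha u P t x)) => //.
  have [_ ->//] := bellman_fenchel m0 alpha ell phi F m1 pi u gamma P t x
    (lNy t x) (doml t x) hMFG.
subst m2 D; set c := (((m1, w), m1), opA alpha w); set k := (u, (gamma, P)).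
have flux (m : 'M[R]_(T.+1, n)) w' : opS w' - m + m0bar T m0 = 0 ->
    opCK alpha (((m, w'), m), opA alpha w') = (- m0bar T m0, (0, 0)).
  by move=> /eqP; rewrite addr_eq0 /= => /eqP ->; rewrite !subrr.
have hc : opCK alpha c = (- m0bar T m0, (0, 0)).
  exact/flux/(fokker_planck_flux _ _ _ _ hw).
have [p [q [hp hq hcF]]] := calF_MFG m0 alpha ell phi F lP phiP FP
  m1 pi u gamma P w doml hMFG m1_ge0 hw.
rewrite -/c -/k in hcF.
have frakP : solution_frakP m0 alpha ell phi F c.
  split=> // c' _; rewrite !calGE hc eqxx adde0.
  have := calF_ge alpha ell phi F lP phiP FP c' u gamma P bu.
  rewrite -/k hp hq -!EFinB hcF hc.
  case: eqP => [->|_]; first by rewrite adde0.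
  by case: (calF _ _ _ c') => [r| |] // _; rewrite leey.
have Ptilde : solution_Ptilde m0 alpha ell phi F (m1, w).
  split=> [|[m w'] /= hmw]; first exact: fokker_planck_flux.
  have [_ /(_ (((m, w'), m), opA alpha w') Logic.I)] := frakP.
  by rewrite !calGE hc (flux _ _ hmw) eqxx !adde0.
(* the costs also agree where the mass vanishes and the running cost is
   infinite, as 0 * +oo = 0 and the perspective is 0 at the origin *)
have costP (m : 'M[R]_(T.+1, n)) (pi' w' : 'I_T -> 'M[R]_n) :
    (forall s x, 0 <= m s x) ->
    (forall t x, row x (w' t) = m (same_time t) x *: row x (pi' t)) ->
    cost_P alpha ell phi F (m, pi') = cost_Ptilde alpha ell phi F (m, w').
  move=> m_ge0 hw'; congr (_ + _ + _)%E; last first.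
    by apply: eq_bigr => t _; rewrite (opAE _ m pi' w' t hw').
  apply: eq_bigr => t _; apply: eq_bigr => x _.
  by rewrite hw' perspective_scale.
split=> //; split; last split=> //; last split.
- split=> // k' _.
  have adjN c' (l : spaceK R T n) :
      dotC c' (- opCK_adj alpha l) = - dotK (opCK alpha c') l.
    by rewrite dotC_oppr adjoint_opCKP.
  (* The middle term is the opposite of the primal value.  It bounds the dual
     objective at k from above by weak duality at every c', and at k' from
     below by testing both conjugates at the optimal primal point. *)
  apply: (@le_trans _ _ ((p + q)%:E + (dotK (opCK alpha c) k)%:E)%E).
    apply: leeD; apply: ge_ereal_sup => _ [c' _ <-].
      have := calF_ge alpha ell phi F lP phiP FP c' u gamma P bu.
      rewrite adjN -/k hp hq -!EFinB.
      by case: (calF _ _ _ c') => [r| |]//; rewrite ?leNye// -EFinB !lee_fin; lra.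
    by rewrite calGE hc; case: eqP => [->|_]; rewrite ?sube0 ?leNye.
  have := fenchel_ge (@dotC R T n) (calF ell phi F) c (- opCK_adj alpha k').
  have := fenchel_ge (@dotK R T n) (calG m0) (opCK alpha c) k'.
  rewrite adjN calGE hc eqxx sube0 -hc hcF => G_ge F_ge.
  apply: le_trans (leeD F_ge G_ge).
  by rewrite -EFinB -!EFinD lee_fin; lra.
- split=> [|[m pi'] [hpi' hFP']]; first by split.
  pose w' t := \matrix_(x, y) (m (same_time t) x * pi' t x y).
  have hw' t x : row x (w' t) = m (same_time t) x *: row x (pi' t).
    by apply/rowP => y; rewrite !mxE.
  rewrite (costP _ _ _ m1_ge0 hw).
  rewrite (costP _ _ _ (fokker_planck_ge0 _ _ _ hm0 hpi' hFP') hw').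
  have [_] := Ptilde; apply; exact: fokker_planck_flux hFP'.
- split=> // -[gamma' P'] _ /=.
  rewrite (backwardU_unique _ _ lfin _ _ _ bu).
  have bu' := backwardUP alpha ell lfin gamma' P'.
  have := calF_ge alpha ell phi F lP phiP FP c _ _ _ bu'.
  by rewrite hcF hp hq hc !dotK_m0bar !opprK -!EFinB.
Qed.
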